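(* Let $\mathfrak{e}\subset\mathbb{C}$ be a compact set that is not finite, and for each $m\ge 1$ let $t_m = \|T_m\|_{\mathfrak{e}}$, where $T_m$ is the degree $m$ Chebyshev polynomial of $\mathfrak{e}$. Let $n\ge 1$. If $t_n = C(\mathfrak{e})^n$, then $t_{nk} = C(\mathfrak{e})^{nk}$ for all $k=1,2,\dots$.
   Context: For a compact, not finite set $\mathfrak{e}\subset\mathbb{C}$ and a continuous function $f$ on $\mathfrak{e}$, $\|f\|_{\mathfrak{e}} = \sup_{z\in\mathfrak{e}}|f(z)|$. The Chebyshev polynomial $T_m$ of $\mathfrak{e}$ is the unique monic polynomial of degree $m$ minimizing $\|P\|_{\mathfrak{e}}$ over all monic polynomials $P$ of degree $m$. $C(\mathfrak{e})$ denotes the logarithmic capacity of $\mathfrak{e}$. *)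

(* Defs.v *)
From mathcomp Require Import all_boot all_order all_algebra.
From mathcomp Require Import all_classical all_reals all_analysis.
From mathcomp Require Import complex.

Set Implicit Arguments.
Unset Strict Implicit.
Unset Printing Implicit Defensive.

Import Order.TTheory GRing.Theory Num.Theory.
Import numFieldNormedType.Exports.
Import ComplexField.Normc.

Local Open Scope classical_set_scope.
Local Open Scope ring_scope.

(* The library puts the norm topology on R[i]^o, which is convertible to R[i];
   sets of complex numbers are therefore typed as subsets of R[i]^o.
   The library's `|z| lies in R[i]; normc is the R-valued modulus. *)

Definition sup_norm (R : realType) (e : set R[i]^o) (f : R[i] -> R[i]) : R :=
  sup [set normc (f z) | z in e].

(* When e is compact and infinite, exactly one P satisfies this for each m. *)
Definition is_chebyshev (R : realType) (e : set R[i]^o) (m : nat)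
    (P : {poly R[i]}) : Prop :=
  [/\ P \is monic, size P = m.+1 &
      forall Q : {poly R[i]}, Q \is monic -> size Q = m.+1 ->
        sup_norm e (horner P) <= sup_norm e (horner Q)].

Definition borelC (R : realType) := g_sigma_algebraType (@open R[i]^o).

(* log |z - w|^-1, equal to +oo when z = w because lne 0 = -oo *)
Definition log_kernel (R : realType) (z w : R[i]) : \bar R :=
  (- lne (normc (z - w))%:E)%E.

Definition log_energy (R : realType) (mu : probability (borelC R) R) : \bar R :=
  (\int[mu]_z \int[mu]_w log_kernel z w)%E.

(* exp (- inf), the infimum being over the Borel probability measures carried
   by e. For e compact and nonempty the infimum is in ]-oo, +oo], so the
   exponential is finite; it is 0 when every such measure has infinite energy. *)
Definition capacity (R : realType) (e : set R[i]^o) : R :=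
  fine (expeR (- ereal_inf [set log_energy mu |
    mu in [set mu : probability (borelC R) R | mu e = 1%E]])).

(* Main.v *)
(* The upper bound is witnessed by [T n ^+ k].  The lower bound is Szego's
   inequality [capacity e ^+ m <= ||P||_e] for monic [P] of degree [m].  Let [mu] be
   a probability measure on [e] with energy [I].  Choosing points one at a time below
   the conditional expectations yields, for each [N], points [z_i] of [e] with
   [\prod_(i < j) |z_i - z_j| >= exp (- 'C(N, 2) I)].  This product is a Vandermonde
   determinant; row operations replace the monomials by the monic polynomials
   [P^(j / m) X^(j mod m)], so it is at most [N! \prod_j ||P^(j / m) X^(j mod m)||_e].
   Comparing the two bounds to order [N^2] gives [exp (- m I) <= ||P||_e]. *)
Require Import Defs.
From mathcomp Require Import all_boot all_order all_algebra.
From mathcomp Require Import all_classical all_reals all_analysis.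
From mathcomp Require Import complex perm measurable_realfun ring lra.
Import Order.TTheory GRing.Theory Num.Theory.
Import numFieldNormedType.Exports.
Local Open Scope classical_set_scope.
Local Open Scope ring_scope.

Set Implicit Arguments.
Unset Strict Implicit.
Unset Printing Implicit Defensive.

(** * Choice of points by averaging a nonnegative kernel *)

Fixpoint pair_sum (R : realType) (T : Type) (K : T -> T -> \bar R) (s : seq T) :
    \bar R :=
  (if s is z :: s' then \sum_(y <- s') K z y + pair_sum K s' else 0)%E.

Section averaging.
Local Open Scope ereal_scope.
Context d (T : measurableType d) (R : realType) (mu : probability T R).
Variable e : set T.
Hypotheses (me : measurable e) (mue : mu e = 1).

(** If [g] exceeded its mean [c] everywhere on [e], then [c] would be finite and [g - c] would be
    positive on [e] with integral 0 there, hence null almost everywhere, against [mu e = 1]. *)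
Lemma exists_le_integral (g : T -> \bar R) :
  measurable_fun setT g -> (forall x, 0 <= g x) ->
  exists2 z, e z & g z <= \int[mu]_x g x.
Proof.
move=> mg g0; apply: contrapT => hno.
have hgt z : e z -> \int[mu]_x g x < g z.
  by move=> ez; rewrite ltNge; apply/negP => h; apply: hno; exists z.
set c := \int[mu]_x g x in hgt.
have c0 : 0 <= c by apply: integral_ge0.
have [z ez] : exists z, e z.
  apply/set0P/negP => /eqP e0.
  by move: mue; rewrite e0 measure0 => /esym/eqP; rewrite onee_eq0.
have cfin : c \is a fin_num.
  by rewrite ge0_fin_numE// (lt_le_trans (hgt z ez))// leey.
have mge : measurable_fun e g by apply: measurable_funTS.
have mgc : measurable_fun e (fun x => g x - c).
  by apply: emeasurable_funB => //; exact: measurable_cst.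
have gc0 x : e x -> 0 <= g x - c by move=> ex; rewrite sube_ge0 ?cfin// ltW// hgt.
have : \int[mu]_(x in e) (g x - c) + c <= c.
  have -> : \int[mu]_(x in e) (g x - c) + c = \int[mu]_(x in e) g x.
    have {2}-> : c = \int[mu]_(x in e) c by rewrite integral_cst// [X in _ * X]mue mule1.
    rewrite -ge0_integralD//; first by apply: eq_integral => x _; rewrite subeK.
  by apply: ge0_subset_integral.
rewrite -leeBrDr// subee// => h.
have : ae_eq mu e (fun x => g x - c) (cst 0).
  apply/ae_eq_integral_abs => //.
  apply/eqP; rewrite eq_le integral_ge0// andbT.
  apply: le_trans h; rewrite le_eqVlt; apply/orP; left; apply/eqP.
  by apply: eq_integral => x /[!inE] ex; rewrite gee0_abs// gc0.
move=> [A [mA A0 sA]].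
have : mu e <= mu A.
  apply: le_measure; rewrite ?inE// => x ex; apply: sA => /= /(_ ex) /eqP.
  by apply/negP; rewrite gt_eqF// sube_gt0 hgt.
by rewrite A0 mue leNgt lte01.
Qed.

Variable K : T -> T -> \bar R.
Hypothesis mK : measurable_fun setT (fun xy : T * T => K xy.1 xy.2).
Hypothesis K0 : forall x y, 0 <= K x y.

(* The additive term [h] makes the induction go through: once a first point [z] is
   chosen, [h] is replaced by [h + K z]. *)
Lemma exists_pair_sum_le (p : nat) (h : T -> \bar R) :
  measurable_fun setT h -> (forall x, 0 <= h x) ->
  exists s : seq T, [/\ size s = p, {in s, forall x, e x} &
    \sum_(y <- s) h y + pair_sum K s <=
    p%:R%:E * \int[mu]_x h x + ('C(p, 2))%:R%:E * \int[mu]_x \int[mu]_y K x y].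
Proof.
elim: p h => [|p IH] h mh h0.
  by exists [::]; split => //=; rewrite big_nil !mul0e adde0.
pose U x := \int[mu]_y K x y.
have mU : measurable_fun setT U.
  exact: (@measurable_fun_fubini_tonelli_F _ _ T T R mu (fun xy => K xy.1 xy.2)).
have U0 x : 0 <= U x by exact: integral_ge0.
have mKz z : measurable_fun setT (K z).
  exact: (measurableT_comp mK (pair1_measurable z)).
have mpU : measurable_fun setT (fun x => p%:R%:E * U x).
  exact: measurable_funeM.
have p0 : 0 <= p%:R%:E :> \bar R by rewrite lee_fin.
(* Given the first point [x], the conditional expectation of the total depends on [x] through [h x]
   and through its mean interaction [U x] with each of the [p] points still to come. *)
have [] := @exists_le_integral (fun x => h x + p%:R%:E * U x).
- exact: emeasurable_funD.
- by move=> x; rewrite adde_ge0// mule_ge0.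
move=> z ez; rewrite ge0_integralD//; last by move=> x _; rewrite mule_ge0.
rewrite ge0_integralZl//.
have [] := IH (fun x => h x + K z x).
- exact: emeasurable_funD.
- by move=> x; rewrite adde_ge0.
move=> s [sp se]; rewrite big_split/= ge0_integralD// -/(U z).
set H := \int[mu]_x h x; set J := \int[mu]_x U x => hs hz.
have H0 : 0 <= H by exact: integral_ge0.
have J0 : 0 <= J by exact: integral_ge0.
exists (z :: s); split => /=; first by rewrite sp.
  by move=> x; rewrite inE => /orP[/eqP->|/se].
rewrite big_cons -!addeA -/H -/J.
move: hs; rewrite -addeA => hs.
apply: (le_trans (leeD2l (h z) hs)).
have -> : h z + (p%:R%:E * (H + U z) + 'C(p, 2)%:R%:E * J)
  = (h z + p%:R%:E * U z) + (p%:R%:E * H + 'C(p, 2)%:R%:E * J).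
  by rewrite ge0_muleDr// -!addeA; congr (_ + _); rewrite addeCA addeA.
apply: (le_trans (leeD2r _ hz)).
rewrite binS bin1 natrD -natr1 !EFinD !ge0_muleDl ?lee_fin// mul1e.
set a := p%:R%:E * H; set b := p%:R%:E * J; set c := _ * J.
by rewrite addeACA (addeC a) (addeC c).
Qed.

End averaging.

(** * Modulus on the complex plane: continuity, boundedness, Borel measurability *)

Section complex_plane.
Variable R : realType.
Implicit Types z w : R[i].
Notation normc := (@ComplexField.Normc.normc R).

Lemma normr_normc z : `|z| = (normc z)%:C%C.
Proof. by rewrite normc_def; case: z. Qed.

Lemma normc_ge0 z : 0 <= normc z.
Proof. by case: z => a b; rewrite sqrtr_ge0. Qed.

Lemma le_Re_normc z : `|complex.Re z| <= normc z.
Proof. by rewrite -lecR -normr_normc normc_ge_Re. Qed.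

Lemma le_Im_normc z : `|complex.Im z| <= normc z.
Proof. by case: z => a b /=; rewrite -sqrtr_sqr ler_wsqrtr// lerDr sqr_ge0. Qed.

Lemma le_normc_sub z w : `|normc z - normc w| <= normc (z - w).
Proof.
have := ler_dist_dist z w.
by rewrite !normr_normc -(rmorphB (real_complex R)) lecR/= expr0n addr0 sqrtr_sqr.
Qed.

(** Serves the modulus and the real and imaginary parts alike. *)
Lemma continuous_normc_lipschitz (f : R[i] -> R) :
  (forall z w, `|f z - f w| <= normc (z - w)) -> continuous (f : R[i]^o -> R).
Proof.
move=> fL; rewrite /continuous_at => z.
have FF : Filter (nbhs (z : R[i]^o)) by exact: nbhs_filter.
apply/(@cvgrPdist_lt _ R^o _ _ FF) => eps eps0.
have eps0' : 0 < eps%:C%C :> R[i] by rewrite ltcR.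
apply: (@filterS _ (nbhs (z : R[i]^o)) _ (ball (z : R[i]^o) eps%:C%C)).
  move=> w zw; apply: (le_lt_trans (fL z w)).
  by rewrite -ltcR -normr_normc.
exact: nbhsx_ballx.
Qed.

Lemma compact_normc_bounded (e : set R[i]^o) : compact e ->
  exists M : R, forall z, e z -> normc z <= M.
Proof.
move=> ce.
have cn : continuous (normc : R[i]^o -> R).
  by apply: continuous_normc_lipschitz; exact: le_normc_sub.
have ci := continuous_compact (continuous_subspaceT cn) ce.
have [M [_ hM]] := @compact_bounded R R^o _ ci.
exists (M + 1) => z ez; apply: (le_trans (ler_norm _)).
by apply: (hM (M + 1)); rewrite ?ltrDl//; exists z.
Qed.

Lemma measurable_continuousC (f : R[i]^o -> R) :
  continuous f -> measurable_fun setT (f : borelC R -> R).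
Proof.
move=> cf; apply: (measurability _ (RGenOpens.measurableE R)).
move=> _ [_ [a [b ->] <-]]; rewrite setTI; apply: sub_sigma_algebra.
by move/continuousP: cf; apply; exact: interval_open.
Qed.

Lemma compact_measurableC (e : set R[i]^o) : compact e -> measurable (e : set (borelC R)).
Proof.
move=> ce; rewrite -[e]setCK; apply: measurableC.
apply: sub_sigma_algebra; apply: closed_openC.
by apply: compact_closed ce; exact: norm_hausdorff.
Qed.

Lemma measurable_lne : measurable_fun setT (@lne R \o EFin).
Proof.
rewrite /lne /comp; apply: measurable_fun_ifT => //.
  exact: measurable_fun_ler.
by apply/measurable_EFinP; exact: measurable_ln.
Qed.

Lemma expeR_lne_normc z : expeR (lne (normc z)%:E) = (normc z)%:E.
Proof. by apply/eqP; rewrite lneK_eq lee_fin normc_ge0. Qed.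

End complex_plane.

(** * Logarithmic energy and the shifted kernel *)

Section energy.
Variable R : realType.
Notation normc := (@ComplexField.Normc.normc R).
Local Open Scope ereal_scope.

(** Measurability is for the product of the two Borel sigma-algebras, so the kernel is written
    through the real and imaginary parts of each variable separately. *)
Lemma measurable_log_kernel :
  measurable_fun setT (fun zw : borelC R * borelC R => log_kernel zw.1 zw.2).
Proof.
have mRe : measurable_fun setT (@complex.Re R : borelC R -> R).
  apply: measurable_continuousC; apply: continuous_normc_lipschitz => z w.
  by rewrite -raddfB le_Re_normc.
have mIm : measurable_fun setT (@complex.Im R : borelC R -> R).
  apply: measurable_continuousC; apply: continuous_normc_lipschitz => z w.
  by rewrite -raddfB le_Im_normc.
have m1 (f : borelC R -> R) : measurable_fun setT f ->
    measurable_fun setT (fun zw : borelC R * borelC R => f zw.1 - f zw.2)%R.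
  by move=> mf; apply: measurable_funB; apply: measurableT_comp.
have -> : (fun zw : borelC R * borelC R => log_kernel zw.1 zw.2) =
  fun zw => - (@lne R \o EFin) (Num.sqrt ((complex.Re zw.1 - complex.Re zw.2) ^+ 2 +
     (complex.Im zw.1 - complex.Im zw.2) ^+ 2)%R).
  by apply/funext => -[[a b] [c d]].
apply: measurableT_comp => //; apply: (measurableT_comp (@measurable_lne R)).
apply: (measurableT_comp (continuous_measurable_fun (@sqrt_continuous R))).
by apply: measurable_funD; apply: measurable_funX; exact: m1.
Qed.

Section shifted_integral.
Context d (T : measurableType d) (mu : probability T R) (e : set T).
Hypotheses (me : measurable e) (mue : mu e = 1).

Lemma ae_carrier (P : T -> Prop) : (forall x, e x -> P x) -> {ae mu, forall x, P x}.
Proof.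
move=> eP; exists (~` e); split; first exact: measurableC.
  by rewrite probability_setC// mue subee.
by move=> x /= nPx ex; exact/nPx/eP.
Qed.

(** The lower bound on [e] makes the integral of the negative part at most [L], hence finite, so [L]
    can be moved across the integral even if the positive part has integral [+oo]. *)
Lemma integral_shift (f : T -> \bar R) (L : R) : (0 <= L)%R ->
  measurable_fun setT f ->
  (forall x, e x -> - L%:E <= f x) ->
  \int[mu]_x maxe (f x + L%:E) 0 = \int[mu]_x f x + L%:E.
Proof.
move=> L0 mf fL.
have mg : measurable_fun setT (fun x => maxe (f x + L%:E) 0).
  by apply: measurable_maxe => //; exact: emeasurable_funD.
have mn := measurable_funeneg mf; have mp := measurable_funepos mf.
have neg_le : \int[mu]_x f^\- x <= L%:E.
  have -> : L%:E = \int[mu]_x L%:E by rewrite integral_cst// [X in _ * X]probability_setT mule1.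
  apply: ae_ge0_le_integral => //.
  apply: ae_carrier => x ex _.
  by rewrite funenegE ge_max lee_fin L0 andbT leeNl fL.
have neg_fin : \int[mu]_x f^\- x \is a fin_num.
  rewrite ge0_fin_numE; first exact: le_lt_trans neg_le (ltry _).
  exact: integral_ge0.
rewrite [in RHS]integralE addeAC.
have -> : \int[mu]_x f^\+ x + L%:E = \int[mu]_x (f^\+ x + L%:E).
  by rewrite ge0_integralD// integral_cst// [X in _ * X]probability_setT mule1.
(* The identity [max (f + L) 0 + f^- = f^+ + L] on [e] involves nonnegative terms only; the finite
   integral of [f^-] is cancelled at the end. *)
have <- : \int[mu]_x maxe (f x + L%:E) 0 + \int[mu]_x f^\- x =
    \int[mu]_x (f^\+ x + L%:E).
  rewrite -ge0_integralD//; last by move=> x _; rewrite le_max lexx orbT.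
  apply: ge0_ae_eq_integral => //.
  - by apply: emeasurable_funD.
  - by apply: emeasurable_funD.
  - by move=> x _; rewrite adde_ge0// le_max lexx orbT.
  - by move=> x _; rewrite adde_ge0.
  apply: ae_carrier => x ex _.
  have fL0 : 0 <= f x + L%:E by rewrite -leeBlDr// sub0e fL.
  rewrite (max_idPl fL0) addeAC; congr (_ + _).
  rewrite funeposE funenegE.
  have [f0|/ltW f0] := leP 0 (f x).
    by rewrite max_r ?oppe_le0// adde0.
  rewrite max_l ?oppe_ge0// subee//.
  by rewrite fin_numE -ltNye -ltey (le_lt_trans f0)// (lt_le_trans (ltNyr (- L)))// fL.
by rewrite addeK.
Qed.

End shifted_integral.

(** The kernel changes sign, so Tonelli's theorem is applied to its positive and negative parts
    separately. *)
Lemma measurable_potential (mu : probability (borelC R) R) :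
  measurable_fun setT (fun z : borelC R => \int[mu]_w log_kernel z w).
Proof.
pose k (zw : borelC R * borelC R) := log_kernel zw.1 zw.2.
have mk : measurable_fun setT k := measurable_log_kernel.
have -> : (fun z => \int[mu]_w log_kernel z w) =
  (fun z => \int[mu]_w k^\+ (z, w) - \int[mu]_w k^\- (z, w)).
  apply/funext => z; rewrite integralE; congr (_ - _).
    by apply: eq_integral => w _; rewrite !funeposE.
  by apply: eq_integral => w _; rewrite !funenegE.
apply: emeasurable_funB.
  by apply: (@measurable_fun_fubini_tonelli_F _ _ _ _ R mu) => //;
    exact: measurable_funepos.
by apply: (@measurable_fun_fubini_tonelli_F _ _ _ _ R mu) => //;
    exact: measurable_funeneg.
Qed.

Variables (e : set R[i]^o) (L : R).
Hypotheses (L0 : (0 <= L)%R) (me : measurable (e : set (borelC R)))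
  (eL : forall z w, e z -> e w -> (normc (z - w) <= expR L)%R).

(* The truncation at 0 only matters off [e]: it makes the kernel nonnegative
   everywhere, so that Tonelli's theorem applies on the whole plane. *)
Definition shifted_kernel (z w : borelC R) := maxe (log_kernel z w + L%:E) 0.

Lemma log_kernel_ge z w : e z -> e w -> - L%:E <= log_kernel z w.
Proof.
by move=> ez ew; rewrite leeN2 -lee_expeR expeR_lne_normc lee_fin eL.
Qed.

Lemma integral_shifted_kernel_le (mu : probability (borelC R) R) : mu e = 1 ->
  \int[mu]_z \int[mu]_w shifted_kernel z w <= log_energy mu + L%:E.
Proof.
move=> mue.
have mk (z : borelC R) : measurable_fun setT (log_kernel z : borelC R -> \bar R).
  exact: (measurableT_comp measurable_log_kernel (pair1_measurable z)).
have ms : measurable_fun setT (fun zw : borelC R * borelC R => shifted_kernel zw.1 zw.2).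
  apply: measurable_maxe => //; apply: emeasurable_funD => //.
  exact: measurable_log_kernel.
have inner (z : borelC R) : e z -> \int[mu]_w shifted_kernel z w = \int[mu]_w log_kernel z w + L%:E.
  move=> ez; apply: (integral_shift me mue L0 (mk z)) => w ew.
  exact: log_kernel_ge.
(* Second use of the shift, now for the potential: it is at least [- L] on [e] because its shifted
   form is the integral of a nonnegative kernel. *)
rewrite /log_energy -(integral_shift me mue L0) //; last 2 first.
- exact: measurable_potential.
- move=> z ez; rewrite -[X in X <= _]sub0e leeBlDr// -inner//.
  by apply: integral_ge0 => w _; rewrite /shifted_kernel le_max lexx orbT.
have k0 z w : 0 <= shifted_kernel z w by rewrite /shifted_kernel le_max lexx orbT.
apply: ae_ge0_le_integral => //.
- by move=> z _; exact: integral_ge0.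
- exact: (@measurable_fun_fubini_tonelli_F _ _ _ _ R mu (fun zw => shifted_kernel zw.1 zw.2)).
- by move=> z _; rewrite le_max lexx orbT.
- apply: measurable_maxe => //; apply: emeasurable_funD => //.
  exact: measurable_potential.
- by apply: (ae_carrier me mue) => z ez _; rewrite inner// le_max lexx.
Qed.

End energy.

(** * Products of distances as Vandermonde determinants *)

Section vandermonde.
Variable R : realType.
Notation normc := (@ComplexField.Normc.normc R).

Fixpoint pair_prod (s : seq R[i]) : R :=
  if s is z :: s' then (\prod_(y <- s') normc (z - y)) * pair_prod s' else 1.

Lemma normc_prod (I : Type) (r : seq I) (P : pred I) (F : I -> R[i]) :
  normc (\prod_(i <- r | P i) F i) = \prod_(i <- r | P i) normc (F i).
Proof.
apply: (big_morph normc); first exact: ComplexField.Normc.normcM.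
exact: ComplexField.Normc.normc1.
Qed.

Lemma normcX (z : R[i]) (n : nat) : normc (z ^+ n) = normc z ^+ n.
Proof. by rewrite -[n]card_ord -prodr_const normc_prod prodr_const. Qed.

Lemma pair_prodE (s : seq R[i]) :
  pair_prod s = normc (\det (Vandermonde (size s) (\row_j s`_j))).
Proof.
rewrite det_Vandermonde normc_prod.
under eq_bigr => i _ do rewrite normc_prod.
elim: s => [|z s IH] /=; first by rewrite big_ord0.
rewrite [RHS]big_ord_recl; congr (_ * _).
  rewrite [RHS]big_mkcond [RHS]big_ord_recl /= mul1r (big_nth 0) big_mkord.
  apply: eq_bigr => j _.
  by rewrite /= !mxE/= -opprB normcN.
rewrite IH; apply: eq_bigr => i _.
rewrite [RHS]big_mkcond big_ord_recl/= mul1r [LHS]big_mkcond; apply: eq_bigr => j _.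
by rewrite !mxE /= /bump /= !add1n ltnS.
Qed.

(** Leibniz expansion with [n!] terms. The factor [n!] is harmless, since its logarithm is of
    smaller order than [n ^ 2]. *)
Lemma normc_det_le (n : nat) (A : 'M[R[i]]_n) (B : 'I_n -> R) :
  (forall i j, normc (A i j) <= B i) -> normc (\det A) <= n`!%:R * \prod_i B i.
Proof.
move=> AB; rewrite -lecR -normr_normc /determinant.
apply: (le_trans (ler_norm_sum _ _ _)).
have -> : (n`!%:R * \prod_i B i)%:C%C = \sum_(s : 'S_n) (\prod_i B i)%:C%C.
  by rewrite sumr_const -card_Sn rmorphM/= rmorph_nat mulr_natl.
apply: ler_sum => s _.
rewrite normrM normrX normrN1 expr1n mul1r normr_normc lecR normc_prod.
by apply: ler_prod => i _; rewrite normc_ge0 AB.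
Qed.

(* Row operations: replacing the monomials by monic polynomials of the same
   degrees multiplies the Vandermonde matrix by a unitriangular one. *)
Lemma det_Vandermonde_monic (F : comNzRingType) (n : nat) (P : nat -> {poly F})
    (a : 'rV[F]_n) :
  (forall i, P i \is monic) -> (forall i, size (P i) = i.+1) ->
  \det (\matrix_(i < n, j < n) (P i).[a 0 j]) = \det (Vandermonde n a).
Proof.
move=> Pm Ps.
pose L := \matrix_(i < n, j < n) (P i)`_j.
have -> : \matrix_(i < n, j < n) (P i).[a 0 j] = L *m Vandermonde n a.
  apply/matrixP => i j; rewrite !mxE (@horner_coef_wide _ n) ?Ps//.
  by apply: eq_bigr => k _; rewrite !mxE.
rewrite det_mulmx det_trig; last first.
  by apply/is_trig_mxP => i j ij; rewrite mxE nth_default// Ps.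
rewrite big1 ?mul1r// => i _; rewrite mxE.
by have /monicP := Pm i; rewrite /lead_coef Ps.
Qed.

Lemma pair_prod_le_monic (e : set R[i]) (P : nat -> {poly R[i]}) (B : nat -> R)
    (s : seq R[i]) :
  (forall i, P i \is monic) -> (forall i, size (P i) = i.+1) ->
  (forall i z, e z -> normc (P i).[z] <= B i) -> {in s, forall z, e z} ->
  pair_prod s <= (size s)`!%:R * \prod_(i < size s) B i.
Proof.
move=> Pm Ps PB se; rewrite pair_prodE -(det_Vandermonde_monic _ Pm Ps).
by apply: normc_det_le => i j; rewrite !mxE; apply: PB; apply: se; rewrite mem_nth.
Qed.

End vandermonde.

(** * Points of [e] with a large product of mutual distances *)

Section energy_points.
Variables (R : realType) (e : set R[i]^o) (L : R).
Notation normc := (@ComplexField.Normc.normc R).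
Local Open Scope ereal_scope.

Lemma shifted_kernel_ge0 z w : 0 <= shifted_kernel L z w.
Proof. by rewrite le_max lexx orbT. Qed.

(** The truncation only raises the kernel, so it lowers the exponential: the right direction for
    bounding distances from below. *)
Lemma expeR_shifted_kernel z w :
  expeR (- shifted_kernel L z w) <= (normc (z - w) * expR (- L))%:E.
Proof.
apply: (@le_trans _ _ (expeR (- (log_kernel z w + L%:E)))).
  by rewrite lee_expeR leeN2 le_max lexx.
rewrite fin_num_oppeD// /log_kernel oppeK expeRD EFinM.
by rewrite lee_pmul2r// ?lte_fin ?expR_gt0// expeR_lne_normc.
Qed.

Lemma pair_sum_ge0 (T : Type) (K : T -> T -> \bar R) s :
  (forall x y, 0 <= K x y) -> 0 <= pair_sum K s.
Proof. by move=> K0; elim: s => //= z s IH; rewrite adde_ge0// sume_ge0. Qed.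

Lemma expeR_sum_shifted_kernel z (s : seq R[i]) :
  expeR (- \sum_(y <- s) shifted_kernel L z y) <=
  (\prod_(y <- s) normc (z - y) * expR (- L) ^+ size s)%:E.
Proof.
elim: s => [|y s IH]; first by rewrite !big_nil oppe0 expeR0 mulr1.
rewrite !big_cons /= oppeD; last first.
  apply: ge0_adde_def; rewrite inE ?shifted_kernel_ge0// sume_ge0// => *.
  exact: shifted_kernel_ge0.
by rewrite expeRD exprS mulrACA EFinM lee_pmul// ?expeR_ge0// expeR_shifted_kernel.
Qed.

Lemma expeR_pair_sum (s : seq R[i]) :
  expeR (- pair_sum (shifted_kernel L) s) <=
  (pair_prod s * expR (- L) ^+ 'C(size s, 2))%:E.
Proof.
elim: s => [|z s IH]; first by rewrite [pair_sum _ _]/= oppe0 expeR0 mulr1.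
rewrite [pair_sum _ _]/= [pair_prod _]/= [size _]/= oppeD; last first.
  apply: ge0_adde_def; rewrite inE ?pair_sum_ge0// ?sume_ge0// => *; exact: shifted_kernel_ge0.
rewrite expeRD binS bin1 addnC exprD mulrACA EFinM lee_pmul// ?expeR_ge0//.
exact: expeR_sum_shifted_kernel.
Qed.

Hypotheses (L0 : (0 <= L)%R) (me : measurable (e : set (borelC R)))
  (eL : forall z w, e z -> e w -> (normc (z - w) <= expR L)%R).

(** Each of the ['C(N, 2)] pairs carries a factor [expR (- L)], which cancels the [L] added to the
    energy. The real bound [b] stands for the energy, which is an extended real. *)
Lemma exists_pair_prod_ge (mu : probability (borelC R) R) (b : R) (N : nat) :
  mu e = 1 -> log_energy mu <= b%:E ->
  exists s : seq R[i], [/\ size s = N, {in s, forall z, e z} &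
    (expR (- ('C(N, 2)%:R * b)) <= pair_prod s)%R].
Proof.
move=> mue Ib.
have [] := @exists_pair_sum_le _ _ _ mu e me mue (shifted_kernel L) _ _ N (cst 0).
- apply: measurable_maxe => //; apply: emeasurable_funD => //.
  exact: measurable_log_kernel.
- exact: shifted_kernel_ge0.
- exact: measurable_cst.
- by [].
move=> s [sN se]; rewrite big1// integral0 mule0 !add0e => hs.
exists s; split=> //.
have sle : pair_sum (shifted_kernel L) s <= ('C(N, 2)%:R * (b + L))%:E.
  apply: (le_trans hs); rewrite EFinM lee_wpmul2l ?lee_fin// EFinD.
  apply: (le_trans (integral_shifted_kernel_le L0 me eL mue)).
  by rewrite leeD2r.
have : expeR (- ('C(N, 2)%:R * (b + L))%:E) <=
    (pair_prod s * expR (- L) ^+ 'C(size s, 2))%:E.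
  by apply: le_trans (expeR_pair_sum s); rewrite lee_expeR leeN2.
by rewrite sN lee_fin -expRM_natl mulrDr opprD expRD mulrN ler_pM2r// expR_gt0.
Qed.

End energy_points.

(** * Elementary growth estimates *)

Section growth.
Variable R : realType.

Lemma binom2_double (n : nat) : 'C(n, 2)%:R * 2 = n%:R * (n%:R - 1) :> R.
Proof.
elim: n => [|n IH]; first by rewrite mul0r mul0r.
by rewrite binS bin1 natrD mulrDl IH -natr1; ring.
Qed.

Lemma ln_fact_le (n : nat) : (0 < n)%N -> ln n`!%:R <= n%:R * ln n%:R :> R.
Proof.
move=> n0; rewrite mulr_natl -lnXn ?ltr0n// ler_ln ?posrE ?exprn_gt0 ?ltr0n ?fact_gt0//.
rewrite -natrX ler_nat fact_prod.
apply: (@leq_trans (\prod_(1 <= i < n.+1) n)%N).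
  rewrite big_nat_cond [leqRHS]big_nat_cond.
  by apply: leq_prod => i /andP[/andP[]].
by rewrite prod_nat_const_nat subn1.
Qed.

Lemma le0_of_quadratic_le (D A C : R) :
  (forall s : nat, (0 < s)%N -> D * s%:R ^+ 2 <= A + C * s%:R) -> D <= 0.
Proof.
move=> H; rewrite leNgt; apply/negP => D0.
(* With [D] positive, this [s] satisfies [A + C s <= (|A| + |C|) s < D s ^ 2]. *)
pose s := (Num.truncn ((`|A| + `|C|) / D)).+1.
have s0 : (0 < s%:R :> R) by rewrite ltr0n.
have : (`|A| + `|C|) / D < s%:R by exact: truncnS_gt.
rewrite ltr_pdivrMr// => h.
have := H s isT; apply/negP; rewrite -ltNge.
have s1 : (1 <= s%:R :> R) by rewrite ler1n.
apply: (@le_lt_trans _ _ ((`|A| + `|C|) * s%:R)).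
  rewrite mulrDl lerD//; last by rewrite ler_wpM2r ?ler_norm// ltW.
  by rewrite (le_trans (ler_norm A))// ler_peMr.
by rewrite expr2 mulrA ltr_pM2r// mulrC.
Qed.

(** For [j < m q], the quotient [j %/ m] takes each value below [q] exactly [m] times. *)
Lemma prod_expr_div (t c : R) (m q : nat) : (0 < m)%N ->
  \prod_(j < m * q) (t ^+ (j %/ m) * c) = t ^+ (m * 'C(q, 2)) * c ^+ (m * q).
Proof.
move=> m0; elim: q => [|q IH]; first by rewrite !muln0 big_ord0 mulr1.
rewrite mulnS addnC big_split_ord/= IH.
under [X in _ * X]eq_bigr => r _ do
  rewrite mulnC divnMDl// (divn_small (ltn_ord r)) addn0.
rewrite prodr_const card_ord exprMn -exprM binS bin1 mulnDr.
by rewrite mulrACA -!exprD [(q * m)%N]mulnC.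
Qed.

End growth.

(** * Szego's lower bound for monic polynomials *)

Section szego.
Variable R : realType.
Notation normc := (@ComplexField.Normc.normc R).

(* The Vandermonde determinant of [m s^2] points of [e] is bounded below by the
   energy and above by the norms of the monic polynomials [P^(j / m) X^(j mod m)];
   the comparison is one of quadratic polynomials in [s^2] up to lower order.  The
   square makes the crude bound [ln s <= s] enough to absorb [ln (m s^2)!]. *)
Lemma log_energy_ge_monic (e : set R[i]^o) (M t b : R) (P : {poly R[i]}) (m : nat)
    (mu : probability (borelC R) R) :
  measurable (e : set (borelC R)) -> 1 <= M -> (forall z, e z -> normc z <= M) ->
  P \is monic -> size P = m.+1 -> (0 < m)%N -> 0 < t ->
  (forall z, e z -> normc P.[z] <= t) ->
  mu e = 1%E -> (log_energy mu <= b%:E)%E -> - (m%:R * b) <= ln t.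
Proof.
move=> me M1 eM Pm Ps m0 t0 Pt mue Ib.
have M0 : 0 < M by exact: lt_le_trans M1.
have MM : 0 < M * 2 by rewrite mulr_gt0.
(* [M * 2] bounds the diameter of [e]. *)
have L0 : 0 <= ln (M * 2) by apply: ln_ge0; lra.
have eL z w : e z -> e w -> normc (z - w) <= expR (ln (M * 2)).
  move=> ez ew; rewrite lnK ?posrE// (le_trans (le_normcD _ _))// normcN.
  by rewrite mulr_natr mulr2n lerD// eM.
(* As [1 <= M], the single factor [M ^+ m] dominates every [M ^+ (j %% m)]. *)
pose B j := t ^+ (j %/ m) * M ^+ m.
have B0 j : 0 < B j by rewrite mulr_gt0// exprn_gt0.
pose Q j : {poly R[i]} := P ^+ (j %/ m) * 'X^(j %% m).
have Qm j : Q j \is monic by rewrite monicMr ?monicXn// monic_exp.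
have Qs j : size (Q j) = j.+1.
  rewrite size_Mmonic ?monicXn ?monic_neq0 ?monic_exp// size_polyXn addnS/=.
  rewrite -[size _]prednK ?lt0n ?size_poly_eq0 ?monic_neq0 ?monic_exp//.
  by rewrite size_exp Ps addSn mulnC -divn_eq.
have QB j z : e z -> normc (Q j).[z] <= B j.
  move=> ez; rewrite hornerM !horner_exp hornerX ComplexField.Normc.normcM.
  rewrite !normcX ler_pM ?exprn_ge0 ?normc_ge0//.
    by rewrite lerXn2r ?nnegrE ?normc_ge0 ?(ltW t0)// Pt.
  apply: (@le_trans _ _ (M ^+ (j %% m))).
    by rewrite lerXn2r ?nnegrE ?normc_ge0 ?(ltW M0)// eM.
  by rewrite ler_weXn2l// ltnW// ltn_mod.
have m1 : 0 < m%:R :> R by rewrite ltr0n.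
suff : - (m%:R * b) - ln t <= 0 by lra.
(* These coefficients are what is left after doubling the comparison, dividing it by [m s ^ 2], and
   bounding [ln N!] by [N (m + 2 s)]. *)
apply: (@le0_of_quadratic_le R _
  (2 * m%:R - b - ln t + 2 * (m%:R * ln M)) 4) => s s0.
have s1 : 0 < s%:R :> R by rewrite ltr0n.
pose q := (s ^ 2)%N; pose N := (m * q)%N.
have N0 : (0 < N)%N by rewrite muln_gt0 m0 expn_gt0 s0.
have [pts [ptsN ptse ptsI]] := exists_pair_prod_ge L0 me eL N mue Ib.
have := le_trans ptsI (pair_prod_le_monic Qm Qs QB ptse).
rewrite ptsN prod_expr_div// -ler_ln ?posrE ?expR_gt0//; last first.
  by rewrite !mulr_gt0 ?exprn_gt0// ltr0n fact_gt0.
rewrite expRK !lnM ?posrE ?mulr_gt0 ?exprn_gt0 ?ltr0n ?fact_gt0//.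
rewrite !lnXn ?exprn_gt0// -![ln _ *+ _]mulr_natl -[(_ * ln _) *+ _]mulr_natl.
have hN : ln N%:R <= m%:R + 2 * s%:R :> R.
  rewrite natrM natrX lnM ?posrE ?exprn_gt0// lnXn// lerD//.
    by rewrite ltW// ln_sublinear.
  by rewrite -[leLHS]mulr_natl ler_wpM2l// ltW// ln_sublinear.
have hf := ln_fact_le R N0.
have hNR : N%:R = m%:R * s%:R ^+ 2 :> R by rewrite natrM natrX.
have hf2 : ln N`!%:R <= m%:R * s%:R ^+ 2 * (m%:R + 2 * s%:R) :> R.
  by apply: (le_trans hf); rewrite -hNR ler_wpM2l.
have cN := binom2_double R N; have cq := binom2_double R q.
rewrite hNR in cN; rewrite natrX in cq.
rewrite -/q -/N natrM hNR => h.
have hp : 0 < m%:R * s%:R ^+ 2 :> R by rewrite mulr_gt0// exprn_gt0.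
rewrite -(ler_pM2l hp).
have cNE : 'C(N, 2)%:R = m%:R * s%:R ^+ 2 * (m%:R * s%:R ^+ 2 - 1) / 2 :> R by lra.
have cqE : 'C(q, 2)%:R = s%:R ^+ 2 * (s%:R ^+ 2 - 1) / 2 :> R by lra.
rewrite cNE cqE in h.
set X := ln N`!%:R in h hf2; set S := s%:R in h hf2 hp *.
set mm := m%:R in h hf2 hp *; set l := ln t in h *; set lM := ln M in h *.
(* Both sides are regrouped so that the remaining inequality is a linear combination of [h] and
   [hf2]. *)
have -> : mm * S ^+ 2 * ((- (mm * b) - l) * S ^+ 2) =
  2 * (- (mm * S ^+ 2 * (mm * S ^+ 2 - 1) / 2 * b)
    - mm * (S ^+ 2 * (S ^+ 2 - 1) / 2) * l) + mm * S ^+ 2 * (- b - l) by field.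
have -> : mm * S ^+ 2 * (2 * mm - b - l + 2 * (mm * lM) + 4 * S) =
  2 * (mm * S ^+ 2 * (mm + 2 * S) + mm * S ^+ 2 * (mm * lM)) + mm * S ^+ 2 * (- b - l).
  by ring.
lra.
Qed.

(** Every carried measure has energy at least [- ln t / m]; this passes to the infimum and then
    through the exponential. *)
Lemma capacity_exp_le (e : set R[i]^o) (t : R) (P : {poly R[i]}) (m : nat) :
  compact e -> P \is monic -> size P = m.+1 -> (0 < m)%N -> 0 < t ->
  (forall z, e z -> normc P.[z] <= t) -> capacity e ^+ m <= t.
Proof.
move=> ce Pm Ps m0 t0 Pt.
have [M0 eM0] := compact_normc_bounded ce.
pose M := Num.max M0 1.
have m1 : 0 < m%:R :> R by rewrite ltr0n.
pose B : R := - (ln t / m%:R).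
have hb (mu : probability (borelC R) R) (b : R) :
    mu e = 1%E -> (log_energy mu <= b%:E)%E -> B <= b.
  move=> mue Ib.
  have : - (m%:R * b) <= ln t.
    apply: (log_energy_ge_monic (M := M) _ _ _ Pm Ps m0 t0 Pt mue Ib).
    - exact: compact_measurableC.
    - by rewrite le_max lexx orbT.
    - by move=> z ez; rewrite le_max eM0.
  by move=> h; rewrite /B lerNl ler_pdivlMr// mulNr [b * _]mulrC.
rewrite /capacity; set I := ereal_inf _.
have BI : (B%:E <= I)%E.
  apply: le_ereal_inf_tmp => _ [mu /= mue <-].
  case E : (log_energy mu) => [r| |]; last 2 first.
  - by rewrite leey.
  (* Energy [-oo] would lie below [B - 1], forcing [B <= B - 1]. *)
  - have := hb mu (B - 1) mue; rewrite E leNye => /(_ isT).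
    by rewrite lerBrDr gerDl ler10.
  by rewrite lee_fin; apply: hb mue _; rewrite E.
have le1 : (expeR (- I) <= (expR (ln t / m%:R))%:E)%E.
  by rewrite -[X in (_ <= X)%E]/(expeR (ln t / m%:R)%:E) lee_expeR leeNl.
(* Without finiteness, [fine] would lose the value. *)
have fin : expeR (- I) \is a fin_num.
  by rewrite ge0_fin_numE ?expeR_ge0// (le_lt_trans le1)// ltry.
have c0 : 0 <= fine (expeR (- I)) by rewrite fine_ge0// expeR_ge0.
have cle : fine (expeR (- I)) <= expR (ln t / m%:R) by rewrite -lee_fin fineK.
rewrite (@le_trans _ _ (expR (ln t / m%:R) ^+ m))//.
  by rewrite lerXn2r// nnegrE expR_ge0.
by rewrite -expRM_natl mulrC divfK ?gt_eqF// lnK.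
Qed.

Lemma normc_horner_le_sup_norm (e : set R[i]^o) (P : {poly R[i]}) z :
  compact e -> e z -> normc P.[z] <= sup_norm e (horner P).
Proof.
move=> ce ez; apply: ub_le_sup; last by exists z.
have [M eM] := compact_normc_bounded ce.
(* The real supremum is an upper bound only for a bounded set; the triangle inequality on
   coefficients supplies the bound. *)
exists (\sum_(i < size P) normc P`_i * M ^+ i) => _ [w ew <-].
rewrite -lecR -normr_normc horner_coef (le_trans (ler_norm_sum _ _ _))//.
rewrite rmorph_sum; apply: ler_sum => i _.
rewrite normrM normrX !normr_normc -rmorphXn -rmorphM lecR ler_wpM2l ?normc_ge0//.
by rewrite lerXn2r ?nnegrE ?normc_ge0 ?eM// (le_trans (normc_ge0 w))// eM.
Qed.

Lemma capacity_exp_le_sup_norm (e : set R[i]^o) (P : {poly R[i]}) (m : nat) :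
  compact e -> e !=set0 -> P \is monic -> size P = m.+1 -> (0 < m)%N ->
  capacity e ^+ m <= sup_norm e (horner P).
Proof.
(* The slack [eps] makes the bound positive, so that its logarithm can be used. *)
move=> ce [z ez] Pm Ps m0; apply/ler_addgt0Pr => eps eps0.
have nle := normc_horner_le_sup_norm P ce.
apply: (capacity_exp_le ce Pm Ps m0).
  by rewrite (lt_le_trans eps0)// lerDr (le_trans (normc_ge0 _) (nle z ez)).
by move=> w ew; rewrite (le_trans (nle w ew))// lerDl ltW.
Qed.

End szego.

Theorem theorem1p3 (R : realType) (e : set R[i]^o) (T : nat -> {poly R[i]})
    (n : nat) :
  compact e -> ~ finite_set e ->
  (forall m : nat, (1 <= m)%N -> is_chebyshev e m (T m)) ->
  (1 <= n)%N ->
  sup_norm e (horner (T n)) = capacity e ^+ n ->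
  forall k : nat, (1 <= k)%N ->
    sup_norm e (horner (T (n * k)%N)) = capacity e ^+ (n * k)%N.
Proof.
move=> ce einf chT n0 tn k k0.
have e0 : e !=set0.
  by apply/set0P/negP => /eqP e0; apply: einf; rewrite e0; exact: finite_set0.
have nk0 : (0 < n * k)%N by rewrite muln_gt0 n0 k0.
have [Tnm Tns _] := chT n n0; have [Tm Ts Tmin] := chT _ nk0.
apply/eqP; rewrite eq_le capacity_exp_le_sup_norm// andbT.
apply: (@le_trans _ _ (sup_norm e (horner (T n ^+ k)))).
  apply: Tmin; first exact: monic_exp.
  rewrite -[size _]prednK ?lt0n ?size_poly_eq0 ?monic_neq0 ?monic_exp//.
  by rewrite size_exp Tns.
(* By [tn] the target becomes the [k]-th power of the norm of [T n], and the bound can be checked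
   point by point. *)
rewrite exprM -tn; apply: ge_sup.
  by have [z ez] := e0; eexists; exists z.
move=> _ [z ez <-].
have Tz := normc_horner_le_sup_norm (T n) ce ez.
by rewrite horner_exp normcX lerXn2r ?nnegrE ?normc_ge0 ?(le_trans (normc_ge0 _) Tz).
Qed.
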